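(* For every $n\in\mathbb{N}$ there exists a constant $k(n)\geq1$, depending only on $n$, with the following property. Let $C$ be a nonempty compact (not necessarily convex) subset of $\mathbb{R}^n$, let $f:C\to\mathbb{R}$ be a function and $G:C\to\mathbb{R}^n$ a continuous mapping such that (a) $f(x)-f(y)\geq\langle G(y),x-y\rangle$ for all $x,y\in C$; (b) for all $x,y\in C$: if $f(x)-f(y)=\langle G(y),x-y\rangle$, then $G(x)=G(y)$. Then there exists a convex function $F\in C^1(\mathbb{R}^n)$ with $F=f$ on $C$, $\nabla F=G$ on $C$, and $$\sup_{x\in\mathbb{R}^n}|\nabla F(x)|\leq k(n)\,\sup_{y\in C}|G(y)|.$$ In particular, if $0\in C$, then $F$ satisfies $$\|F\|_1\leq k(n)\,\inf\{\|\varphi\|_1:\varphi\in C^1(\mathbb{R}^n),\ \varphi|_C=f,\ (\nabla\varphi)|_C=G\}.$$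
   Context: For $F\in C^1(\mathbb{R}^n)$, $\|F\|_1:=|F(0)|+\sup_{x\in\mathbb{R}^n}|\nabla F(x)|\in[0,\infty]$. *)

(* Defs.v *)
From mathcomp Require Import all_boot all_order all_algebra.
From mathcomp Require Import all_classical all_reals all_analysis.

Set Implicit Arguments.
Unset Strict Implicit.
Unset Printing Implicit Defensive.

Import Order.TTheory GRing.Theory Num.Theory.
Import numFieldNormedType.Exports.

Local Open Scope classical_set_scope.
Local Open Scope ring_scope.

Definition dotv (R : realType) (n : nat) (u v : 'rV[R]_n) : R :=
  \sum_(i < n) u ord0 i * v ord0 i.

(* The norm `|v| that MathComp-Analysis puts on 'rV[R]_n is the sup norm. It
   induces the Euclidean topology and differentiability, but |.| in the
   estimates has to be the Euclidean norm. *)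
Definition enorm (R : realType) (n : nat) (v : 'rV[R]_n) : R :=
  Num.sqrt (dotv v v).

Definition grad (R : realType) (n : nat) (F : 'rV[R]_n -> R) (x : 'rV[R]_n) :
    'rV[R]_n :=
  \row_(i < n) 'D_(delta_mx ord0 i) F x.

(* 'D_v F x has an unspecified value where the derivative does not exist, so
   differentiability must be required separately. *)
Definition C1 (R : realType) (n : nat) (F : 'rV[R]_n -> R) : Prop :=
  (forall x, differentiable F x) /\ continuous (grad F).

Definition sup_enorm (R : realType) (n : nat) (A : set 'rV[R]_n)
    (H : 'rV[R]_n -> 'rV[R]_n) : \bar R :=
  ereal_sup [set (enorm (H x))%:E | x in A].

Definition C1norm (R : realType) (n : nat) (F : 'rV[R]_n -> R) : \bar R :=
  (`|F 0|%:E + sup_enorm setT (grad F))%E.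

(* Main.v *)
Require Import Defs.
(** Let [gap y z = f y - f z - <G z, y - z> >= 0]. By compactness of [C],
    continuity of [G] and (b), [gap] is bounded below by a positive constant where
    [|G y - G z| >= e]. Hence there is a radial function [phi h = |h| eta(|h|)]
    with [eta(t) -> 0] as [t -> 0] and [eta <= 2 M], [M = sup_C |G|], such that
      [g x = inf_(y in C) (f y + <G y, x - y> + phi (x - y))]
    lies above all the tangents [f z + <G z, x - z>], [z] in [C]. Taking [eta] to be
    an infimum of affine functions makes [phi] uniformly smooth:
    [phi (h + k) + phi (h - k) <= 2 phi h + 8 phi k], and such bounds pass to the
    infimum [g]. They also pass to the largest convex minorant [F] of [g], because
    [x |-> (F (x + k) + F (x - k) - 8 phi k) / 2] is again a convex minorant of [g].
    A convex function with second differences [o(|k|)], uniformly, is C^1; and [F],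
    squeezed between the tangents and [g], has the prescribed jet on [C]. The
    Lipschitz constant of [g], hence of [F], is at most [5 M], so [k(n) = 5] works. *)

From HB Require Import structures.
From mathcomp Require Import all_boot all_order all_algebra.
From mathcomp Require Import all_classical all_reals all_analysis.
From mathcomp Require Import zify ring lra.

Set Implicit Arguments.
Unset Strict Implicit.
Unset Printing Implicit Defensive.

Import Order.TTheory GRing.Theory Num.Theory.
Import numFieldNormedType.Exports.

Local Open Scope classical_set_scope.
Local Open Scope ring_scope.

(** * The Euclidean norm and its comparison with the sup norm *)

Section EuclideanNorm.
Context {R : realType} {n : nat}.
Implicit Types (u v w : 'rV[R]_n) (a : R).

Lemma dotvC u v : dotv u v = dotv v u.
Proof. by apply: eq_bigr => i _; rewrite mulrC. Qed.

Lemma dotvDl u v w : dotv (u + v) w = dotv u w + dotv v w.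
Proof. by rewrite -big_split; apply: eq_bigr => i _; rewrite mxE mulrDl. Qed.

Lemma dotvZl a u v : dotv (a *: u) v = a * dotv u v.
Proof. by rewrite mulr_sumr; apply: eq_bigr => i _; rewrite mxE mulrA. Qed.

Lemma dotvNl u v : dotv (- u) v = - dotv u v.
Proof. by rewrite -scaleN1r dotvZl mulN1r. Qed.

Lemma dotvDr u v w : dotv u (v + w) = dotv u v + dotv u w.
Proof. by rewrite dotvC dotvDl !(dotvC u). Qed.

Lemma dotvZr a u v : dotv u (a *: v) = a * dotv u v.
Proof. by rewrite dotvC dotvZl dotvC. Qed.

Lemma dotvNr u v : dotv u (- v) = - dotv u v.
Proof. by rewrite dotvC dotvNl dotvC. Qed.

Definition dotvE := (dotvDl, dotvDr, dotvNl, dotvNr, dotvZl, dotvZr).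

Lemma dotv_ge0 v : 0 <= dotv v v.
Proof. by apply: sumr_ge0 => i _; rewrite -expr2 sqr_ge0. Qed.

Lemma enorm_ge0 v : 0 <= enorm v.
Proof. exact: sqrtr_ge0. Qed.

Lemma sqr_enorm v : enorm v ^+ 2 = dotv v v.
Proof. by rewrite sqr_sqrtr ?dotv_ge0. Qed.

Lemma enorm0_eq0 v : enorm v = 0 -> v = 0.
Proof.
move=> v0; have /eqP := sqr_enorm v.
rewrite v0 expr0n eq_sym psumr_eq0 /=; last by move=> i _; rewrite -expr2 sqr_ge0.
move=> /allP vi0; apply/rowP => i; rewrite mxE.
by have := vi0 i (mem_index_enum i); rewrite mulf_eq0 orbb => /eqP.
Qed.

Lemma dotv0 v : dotv 0 v = 0.
Proof. by rewrite -(scale0r 0) dotvZl mul0r. Qed.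

Lemma enorm0 : enorm (0 : 'rV[R]_n) = 0.
Proof. by rewrite /enorm dotv0 sqrtr0. Qed.

(** Cauchy-Schwarz: the squared norm of [enorm v *: u - enorm u *: v] is 2|u||v|(|u||v| - <u, v>),
    and it is nonnegative. *)
Lemma dotv_le_enorm u v : dotv u v <= enorm u * enorm v.
Proof.
have [u0|u0] := eqVneq (enorm u) 0.
  by rewrite u0 (enorm0_eq0 u0) dotv0 mul0r.
have [v0|v0] := eqVneq (enorm v) 0.
  by rewrite v0 (enorm0_eq0 v0) dotvC dotv0 mulr0.
have ab : 0 < enorm u * enorm v.
  by rewrite mulr_gt0 // lt0r ?u0 ?v0 enorm_ge0.
have := dotv_ge0 (enorm v *: u - enorm u *: v).
rewrite !dotvE -!sqr_enorm (dotvC v u) => h.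
rewrite -subr_ge0 -(pmulr_rge0 _ ab).
by lra.
Qed.

Lemma enorm_sqrD u v :
  enorm (u + v) ^+ 2 = enorm u ^+ 2 + 2 * dotv u v + enorm v ^+ 2.
Proof. by rewrite !sqr_enorm !dotvE (dotvC v u); ring. Qed.

Lemma enormD u v : enorm (u + v) <= enorm u + enorm v.
Proof.
rewrite -(@ler_pXn2r _ 2) // ?nnegrE ?addr_ge0 ?enorm_ge0 //.
by rewrite enorm_sqrD; have := dotv_le_enorm u v; lra.
Qed.

Lemma enormZ a v : enorm (a *: v) = `|a| * enorm v.
Proof.
by rewrite /enorm !dotvE mulrA -expr2 sqrtrM ?sqr_ge0 // sqrtr_sqr.
Qed.

Lemma enormN v : enorm (- v) = enorm v.
Proof. by rewrite -scaleN1r enormZ normrN1 mul1r. Qed.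

Lemma coord_le_enorm v i : `|v ord0 i| <= enorm v.
Proof.
rewrite -(@ler_pXn2r _ 2) // ?nnegrE ?enorm_ge0 // sqr_enorm real_normK ?num_real //.
rewrite /dotv (bigD1 i) //= -expr2 lerDl.
by apply: sumr_ge0 => j _; rewrite -expr2 sqr_ge0.
Qed.

Lemma norm_le_enorm v : `|v| <= enorm v.
Proof.
rewrite /Num.norm /= mx_normrE; apply: bigmax_le; [exact: enorm_ge0|].
by case=> i j _ /=; rewrite (ord1 i); exact: coord_le_enorm.
Qed.

Lemma coord_le_norm v i : `|v ord0 i| <= `|v|.
Proof.
rewrite [leRHS]/Num.norm /= mx_normrE.
exact: (le_bigmax 0 (fun ij : 'I_1 * 'I_n => `|v ij.1 ij.2|) (ord0, i)).
Qed.

(** The crude factor [n.+1] stays positive for [n = 0], so radii can later be divided by it. *)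
Lemma enorm_le_norm v : enorm v <= n.+1%:R * `|v|.
Proof.
rewrite -(@ler_pXn2r _ 2) // ?nnegrE ?enorm_ge0 ?mulr_ge0 // sqr_enorm.
apply: (@le_trans _ _ (\sum_(i < n) `|v| ^+ 2)).
  apply: ler_sum => i _; rewrite -expr2 -(real_normK (num_real _)).
  by rewrite ler_pXn2r ?nnegrE // coord_le_norm.
rewrite sumr_const card_ord exprMn -[leLHS]mulr_natl ler_wpM2r ?sqr_ge0 //.
by rewrite -natrX ler_nat; nia.
Qed.

(** The square root lies below its tangent at |u|^2; adding the bounds for [v] and [- v] cancels the
    terms in <u, v>. *)
Lemma enorm_second_difference u v : 0 < enorm u ->
  enorm (u + v) + enorm (u - v) <= 2 * enorm u + enorm v ^+ 2 / enorm u.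
Proof.
move=> u0.
have root w : enorm (u + w) <=
    enorm u + (2 * dotv u w + enorm w ^+ 2) / (2 * enorm u).
  have : 0 <= (enorm (u + w) - enorm u) ^+ 2 by exact: sqr_ge0.
  rewrite -lerBlDl ler_pdivlMr ?mulr_gt0 //.
  by rewrite sqrrB enorm_sqrD; lra.
apply: (le_trans (lerD (root v) (root (- v)))).
rewrite dotvNr enormN le_eqVlt; apply/orP; left; apply/eqP; field.
by rewrite gt_eqF.
Qed.

End EuclideanNorm.

(** * Moduli that are infima of affine functions, and the radial functions built on them *)

Section LinearModulus.
Context {R : realType} {n : nat}.
Variables (S : set (R * R)) (L : R).
Hypothesis S_ge0 : forall p, S p -> 0 <= p.1 /\ 0 <= p.2.
Hypothesis S_L : S (L, 0).
Hypothesis S_small : forall e, 0 < e -> exists A, S (e, A).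

(** A pair holds the intercept and the slope of an affine function of [t]. The pair [(L, 0)] makes
    the modulus at most [L]; the pairs [(e, A)] make it tend to 0 at 0. *)
Definition modulus (t : R) : R := inf [set p.1 + p.2 * t | p in S].

Local Notation eta := modulus.

Lemma modulus_le p t : S p -> 0 <= t -> eta t <= p.1 + p.2 * t.
Proof.
move=> Sp t0; apply: ge_inf; last by exists p.
by exists 0 => _ [q /S_ge0[q1 q2] <-]; rewrite addr_ge0 // mulr_ge0.
Qed.

(** The factor [d] allows products with [eta] to be checked on each affine function; for [d = 0] the
    pair [(L, 0)] gives [c <= 0]. *)
Lemma le_modulus c d t : 0 <= d ->
  (forall p, S p -> c <= d * (p.1 + p.2 * t)) -> c <= d * eta t.
Proof.
rewrite le_eqVlt => /predU1P[<- /(_ _ S_L)|d0 cS]; first by rewrite !mul0r.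
rewrite -ler_pdivrMl //; apply: lb_le_inf; first by exists (L + 0 * t), (L, 0).
by move=> _ [p Sp <-]; rewrite ler_pdivrMl // cS.
Qed.

Lemma modulus_ge0 t : 0 <= t -> 0 <= eta t.
Proof.
move=> t0; rewrite -[eta t]mul1r; apply: le_modulus => // p /S_ge0[p1 p2].
by rewrite mul1r addr_ge0 // mulr_ge0.
Qed.

Lemma modulus_leL t : 0 <= t -> eta t <= L.
Proof. by move=> t0; have := modulus_le S_L t0; rewrite mul0r addr0. Qed.

Lemma modulus_homo s t : 0 <= s -> s <= t -> eta s <= eta t.
Proof.
move=> s0 st; rewrite -[eta t]mul1r; apply: le_modulus => // p Sp.
have [_ p2] := S_ge0 Sp.
by rewrite mul1r (le_trans (modulus_le Sp s0)) // lerD2l ler_wpM2l.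
Qed.

(** [eta t / t] is nonincreasing because every (p.1 + p.2 t) / t is; the product form covers
    [s = 0]. *)
Lemma modulus_scale s t : 0 <= s -> s <= t -> s * eta t <= t * eta s.
Proof.
move=> s0 st; have t0 := le_trans s0 st.
apply: le_modulus => // p Sp; have [p1 p2] := S_ge0 Sp.
rewrite (le_trans (ler_wpM2l s0 (modulus_le Sp t0))) //.
by rewrite !mulrDr lerD ?ler_wpM2r // !(mulrC p.2) !mulrA (mulrC s).
Qed.

Lemma modulus_small e : 0 < e ->
  exists2 d, 0 < d & forall t, 0 <= t -> t <= d -> eta t <= e.
Proof.
move=> e0; have e20 : 0 < e / 2 by rewrite divr_gt0.
have [A SA] := S_small e20; have [_ /= A0] := S_ge0 SA.
exists (e / 2 / (A + 1)); first by rewrite divr_gt0 // ltr_wpDl.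
move=> t t0 td; rewrite (le_trans (modulus_le SA t0)) //= [leRHS]splitr lerD2l.
move: td; rewrite ler_pdivlMr ?ltr_wpDl // => td.
by apply: le_trans td; rewrite mulrC ler_wpM2l // lerDl.
Qed.

Definition radial (h : 'rV[R]_n) : R := enorm h * eta (enorm h).

Lemma radial_ge0 h : 0 <= radial h.
Proof. by rewrite mulr_ge0 ?modulus_ge0 ?enorm_ge0. Qed.

(** If s > t, split s eta(s) - t eta(t) into (s - t) eta(s) and t (eta(s) - eta(t)). The second is
    at most (s - t) eta(t) by [modulus_scale], and each part is at most L|k|. *)
Lemma radial_lipschitz h k : radial (h + k) <= radial h + 2 * L * enorm k.
Proof.
rewrite /radial; set t := enorm h; set s := enorm (h + k).
have t0 : 0 <= t by exact: enorm_ge0.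
have s0 : 0 <= s by exact: enorm_ge0.
have L0 : 0 <= L by have [] := S_ge0 S_L.
have k0 : 0 <= enorm k by exact: enorm_ge0.
have [st|ts] := leP s t.
  apply: (@le_trans _ _ (t * eta t)).
    by rewrite ler_pM // ?modulus_ge0 // modulus_homo.
  by rewrite lerDl !mulr_ge0.
have sk : s - t <= enorm k by rewrite lerBlDl enormD.
have es := modulus_leL s0; have et := modulus_leL t0.
have sc := modulus_scale t0 (ltW ts).
have h1 : (s - t) * eta s <= (s - t) * L by rewrite ler_wpM2l // subr_ge0 ltW.
have h2 : (s - t) * eta t <= (s - t) * L by rewrite ler_wpM2l // subr_ge0 ltW.
have h3 : (s - t) * L <= enorm k * L by rewrite ler_wpM2r.
by lra.
Qed.

(** If |h| <= |k|, both arguments have norm at most 2|k|, where [radial] is at most [4 * radial k];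
    hence the 8. Otherwise each affine function is estimated separately, with error governed by q =
    |k|^2 / |h|. *)
Lemma radial_second_difference h k :
  radial (h + k) + radial (h - k) <= 2 * radial h + 8 * radial k.
Proof.
have t0 : 0 <= enorm h by exact: enorm_ge0.
have s0 : 0 <= enorm k by exact: enorm_ge0.
have [ts|st] := leP (enorm h) (enorm k).
  have bound v : enorm v <= 2 * enorm k -> radial v <= 4 * radial k.
    move=> vk; have v0 := enorm_ge0 v.
    have k20 : 0 <= 2 * enorm k by exact: le_trans vk.
    have [ek|ek] := eqVneq (enorm k) 0.
      move: vk; rewrite /radial ek mulr0 => vk.
      have -> : enorm v = 0 by apply/eqP; rewrite eq_le vk.
      by rewrite !mul0r mulr0.
    have e2 : eta (2 * enorm k) <= 2 * eta (enorm k).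
      rewrite -(@ler_pM2l _ (enorm k)) ?lt0r ?ek //.
      by rewrite mulrCA mulrA modulus_scale // ler_peMl // ler1n.
    apply: (@le_trans _ _ (2 * enorm k * (2 * eta (enorm k)))).
      apply: ler_pM => //; first exact: modulus_ge0.
      by apply: le_trans e2; exact: modulus_homo.
    by rewrite /radial; lra.
  have b1 : radial (h + k) <= 4 * radial k.
    by apply: bound; rewrite (le_trans (enormD _ _)) // mulr2n mulrDl mul1r lerD2r.
  have b2 : radial (h - k) <= 4 * radial k.
    apply: bound; rewrite (le_trans (enormD _ _)) // enormN.
    by rewrite mulr2n mulrDl mul1r lerD2r.
  by have := radial_ge0 h; lra.
have h0 : 0 < enorm h by exact: le_lt_trans st.
set q := enorm k ^+ 2 / enorm h.
have q0 : 0 <= q by rewrite divr_ge0 ?sqr_ge0.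
(* For one pair, the intercept part is bounded by [enorm_second_difference] and the slope part is
   the parallelogram identity. *)
have key : radial (h + k) + radial (h - k) <=
    (2 * enorm h + 2 * q) * eta (enorm h).
  apply: le_modulus; first by rewrite addr_ge0 // mulr_ge0.
  move=> p Sp; have [p1 p2] := S_ge0 Sp.
  have b v : radial v <= p.1 * enorm v + p.2 * enorm v ^+ 2.
    have := ler_wpM2l (enorm_ge0 v) (modulus_le Sp (enorm_ge0 v)).
    by rewrite /radial; lra.
  have sum2 : enorm (h + k) ^+ 2 + enorm (h - k) ^+ 2 =
      2 * enorm h ^+ 2 + 2 * (q * enorm h).
    by rewrite /q divfK ?gt_eqF // !enorm_sqrD dotvNr enormN; ring.
  have sum1 := ler_wpM2l p1 (enorm_second_difference k h0).
  have := congr1 (fun z => p.2 * z) sum2.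
  have := b (h + k); have := b (h - k).
  have : 0 <= p.1 * q by rewrite mulr_ge0.
  by move: sum1; rewrite -/q; lra.
(* Here |k| < |h|, so eta(|h|) / |h| <= eta(|k|) / |k|. *)
have : q * eta (enorm h) <= radial k.
  rewrite /q /radial expr2 -!mulrA ler_wpM2l // mulrCA ler_pdivrMl //.
    by rewrite modulus_scale // ltW.
have := radial_ge0 k.
by move: key; rewrite /radial; lra.
Qed.

End LinearModulus.

(** * Linearity of the pairing and an epsilon-delta criterion for continuity *)

Lemma dotv_linear (R : realType) (n : nat) (p : 'rV[R]_n) :
  linear (dotv p : 'rV[R]_n -> R^o).
Proof. by move=> a u v; rewrite dotvDr dotvZr. Qed.

HB.instance Definition _ (R : realType) (n : nat) (p : 'rV[R]_n) :=
  GRing.isLinear.Build R 'rV[R]_n R^o _ (dotv p) (dotv_linear p).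

Lemma near_norm_le (R : realType) (V : normedModType R) (x : V) (d : R) :
  0 < d -> \forall y \near x, `|x - y| <= d.
Proof. by move=> d0; apply/nbhs_normP; exists d => // y /ltW. Qed.

Lemma continuous_eps_delta (R : realType) (V W : normedModType R) (f : V -> W) :
  (forall x e, 0 < e ->
    exists2 d, 0 < d & forall y, `|x - y| <= d -> `|f x - f y| <= e) ->
  continuous f.
Proof.
move=> fP x; apply/cvgrPdist_le => e /fP-/(_ x)[d d0 Hd].
exact: filterS (near_norm_le x d0).
Qed.

(** * Convex functions with uniformly small second differences are C^1 *)

Section ConvexRegularity.
Context {R : realType} {n : nat}.
Implicit Types (x y h v w p : 'rV[R]_n).

Definition cvx (F : 'rV[R]_n -> R) : Prop := forall x y t, 0 <= t -> t <= 1 ->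
  F (t *: x + (1 - t) *: y) <= t * F x + (1 - t) * F y.

Variables (F Om : 'rV[R]_n -> R) (L : R).
Hypothesis F_cvx : cvx F.
Hypothesis L_ge0 : 0 <= L.
Hypothesis F_lip : forall x h, F (x + h) <= F x + L * enorm h.
Hypothesis F_smooth : forall x h, F (x + h) + F (x - h) <= 2 * F x + Om h.
Hypothesis Om_small : forall e, 0 < e ->
  exists2 d, 0 < d & forall h, enorm h <= d -> Om h <= e * enorm h.

(** This is the one-sided directional derivative: by convexity the quotients are nondecreasing in
    [t], so their infimum is their limit at 0 from the right. *)
Definition slope x v : R :=
  inf [set (F (x + t *: v) - F x) / t | t in [set t | 0 < t]].

Lemma quotient_lbound x v t : 0 < t -> - (L * enorm v) <= (F (x + t *: v) - F x) / t.
Proof.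
move=> t0; rewrite ler_pdivlMr //.
have := F_lip (x + t *: v) (- (t *: v)).
by rewrite addrK enormN enormZ (gtr0_norm t0); lra.
Qed.

Lemma slope_le x v t : 0 < t -> slope x v <= (F (x + t *: v) - F x) / t.
Proof.
move=> t0; apply: ge_inf; last by exists t.
by exists (- (L * enorm v)) => _ [s s0 <-]; exact: quotient_lbound.
Qed.

Lemma le_slope x v c :
  (forall t, 0 < t -> c <= (F (x + t *: v) - F x) / t) -> c <= slope x v.
Proof.
move=> cq; apply: lb_le_inf; last by move=> _ [t t0 <-]; exact: cq.
by exists ((F (x + 1 *: v) - F x) / 1), 1 => //=.
Qed.

Lemma quotient_homo x v s t : 0 < s -> s <= t ->
  (F (x + s *: v) - F x) / s <= (F (x + t *: v) - F x) / t.
Proof.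
move=> s0 st; have t0 : 0 < t by exact: lt_le_trans st.
have := F_cvx (x + t *: v) x (divr_ge0 (ltW s0) (ltW t0)).
rewrite ler_pdivrMr // mul1r => /(_ st).
have -> : s / t *: (x + t *: v) + (1 - s / t) *: x = x + s *: v.
  by rewrite scalerDr scalerA divfK ?gt_eqF // scalerBl scale1r addrC subrKA.
rewrite ler_pdivrMr // => ?.
suff -> : (F (x + t *: v) - F x) / t * s = s / t * F (x + t *: v) + (1 - s / t) * F x - F x.
  by rewrite lerB.
by rewrite [RHS]addrC; field; rewrite gt_eqF.
Qed.

(** A nearly minimal quotient stays so for every smaller step, so two directions can share one
    step. *)
Lemma slope_approx x v e : 0 < e -> exists2 t, 0 < t &
  forall s, 0 < s -> s <= t -> (F (x + s *: v) - F x) / s <= slope x v + e.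
Proof.
move=> e0; have hi : has_inf [set (F (x + t *: v) - F x) / t | t in [set t | 0 < t]].
  split; first by exists ((F (x + 1 *: v) - F x) / 1), 1 => //=.
  by exists (- (L * enorm v)) => _ [s s0 <-]; exact: quotient_lbound.
have [_ [t t0 <-] lt] := inf_adherent e0 hi.
exists t => // s s0 st; apply: le_trans (ltW lt).
exact: quotient_homo.
Qed.

(** Midpoint convexity: x + (r / 2)(v + w) is the midpoint of x + r v and x + r w. *)
Lemma slopeD_le x v w : slope x (v + w) <= slope x v + slope x w.
Proof.
apply/ler_addgt0Pr => e e0; have e20 : 0 < e / 2 by rewrite divr_gt0.
have [s s0 Hs] := slope_approx x v e20; have [t t0 Ht] := slope_approx x w e20.
set r := Num.min s t; have r0 : 0 < r by rewrite lt_min s0.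
have := Hs r r0; rewrite ge_min lexx => /(_ isT).
have := Ht r r0; rewrite ge_min lexx orbT => /(_ isT).
have := slope_le x (v + w) (divr_gt0 r0 (ltr0n R 2)).
have h0 : 0 <= 1 / 2 :> R by rewrite divr_ge0.
have h1 : 1 / 2 <= 1 :> R by lra.
have := F_cvx (x + r *: v) (x + r *: w) h0 h1.
have -> : (1 / 2) *: (x + r *: v) + (1 - 1 / 2) *: (x + r *: w) =
    x + (r / 2) *: (v + w).
  by apply/rowP => i; rewrite !mxE; field.
rewrite !ler_pdivrMr ?divr_gt0 // ler_pdivlMr ?divr_gt0 //.
by move=> *; rewrite -(ler_pM2r r0); lra.
Qed.

(** Smoothness enters here: the second difference along [t *: v] is o(t). With subadditivity this
    makes the slope odd, hence linear. *)
Lemma slopeN_le x v : slope x v + slope x (- v) <= 0.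
Proof.
apply/ler_addgt0Pr => e e0; rewrite add0r.
have v0 := enorm_ge0 v.
have e1 : 0 < e / (enorm v + 1) by rewrite divr_gt0 // ltr_wpDl.
have [d d0 Hd] := Om_small e1.
set t := d / (enorm v + 1).
have t0 : 0 < t by rewrite divr_gt0 // ltr_wpDl.
have en : enorm (t *: v) <= d.
  rewrite enormZ gtr0_norm // /t mulrAC ler_pdivrMr ?ltr_wpDl //.
  by rewrite ler_wpM2l ?(ltW d0) // lerDl.
have := Hd _ en; rewrite enormZ (gtr0_norm t0).
have := F_smooth x (t *: v).
have := slope_le x v t0; have := slope_le x (- v) t0.
rewrite scalerN !ler_pdivlMr // => h1 h2 h3 h4.
have h5 : e / (enorm v + 1) * (t * enorm v) <= e * t.
  rewrite mulrAC -mulrA ler_wpM2l ?(ltW e0) //.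
  rewrite -mulrA ler_piMr ?(ltW t0) // ler_pdivrMr ?ltr_wpDl // mul1r lerDl //.
by rewrite -(ler_pM2r t0); lra.
Qed.

Lemma slope0 x : slope x 0 = 0.
Proof.
apply/eqP; rewrite eq_le; apply/andP; split.
  by have := slope_le x 0 ltr01; rewrite scaler0 addr0 subrr mul0r.
by apply: le_slope => t t0; rewrite scaler0 addr0 subrr mul0r.
Qed.

Lemma slopeN x v : slope x (- v) = - slope x v.
Proof.
apply/eqP; rewrite eq_le; apply/andP; split.
  by have := slopeN_le x v; lra.
by have := slopeD_le x v (- v); rewrite subrr slope0; lra.
Qed.

(** The reverse inequality is subadditivity at [- v] and [- w]. *)
Lemma slopeD x v w : slope x (v + w) = slope x v + slope x w.
Proof.
apply/eqP; rewrite eq_le slopeD_le /=.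
by have := slopeD_le x (- v) (- w); rewrite -opprD !slopeN; lra.
Qed.

Lemma slopeZ_pos x v a : 0 < a -> slope x (a *: v) = a * slope x v.
Proof.
have le b w : 0 < b -> b * slope x w <= slope x (b *: w).
  move=> b0; apply: le_slope => t t0; rewrite mulrC -ler_pdivlMr //.
  rewrite -mulrA -invfM scalerA; apply: slope_le.
  by rewrite mulr_gt0.
move=> a0; apply/eqP; rewrite eq_le le // andbT.
have ai : 0 < a^-1 by rewrite invr_gt0.
have := le _ (a *: v) ai; rewrite scalerA mulVf ?gt_eqF // scale1r.
by rewrite mulrC ler_pdivrMr // mulrC.
Qed.

Lemma slopeZ x v a : slope x (a *: v) = a * slope x v.
Proof.
have [a0|a0|->] := ltgtP a 0; last by rewrite scale0r slope0 mul0r.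
  rewrite -[a]opprK scaleNr slopeN slopeZ_pos ?oppr_gt0 //.
  by rewrite opprK mulNr opprK.
exact: slopeZ_pos.
Qed.

(** The slope, being linear, is the pairing with its values on the basis, and it is at most the
    quotient at step 1. *)
Lemma ex_subgradient x : exists p, forall h, F x + dotv p h <= F (x + h).
Proof.
exists (\row_i slope x (delta_mx ord0 i)) => h.
have -> : dotv (\row_i slope x (delta_mx ord0 i)) h = slope x h.
  rewrite [in RHS](row_sum_delta h) (big_morph (slope x) (slopeD x) (slope0 x)).
  by apply: eq_bigr => i _; rewrite mxE slopeZ mulrC.
by have := slope_le x h ltr01; rewrite scale1r divr1; lra.
Qed.

(** Insert the subgradient inequality at [- h] into the second-difference bound. *)
Lemma subgradient_upper x p : (forall h, F x + dotv p h <= F (x + h)) ->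
  forall h, F (x + h) <= F x + dotv p h + Om h.
Proof.
by move=> Hp h; have := Hp (- h); have := F_smooth x h; rewrite dotvNr; lra.
Qed.

Lemma Om_dotv_eq0 p : (forall h, dotv p h <= Om h) -> p = 0.
Proof.
move=> Hp; apply: enorm0_eq0; apply/eqP; rewrite eq_le enorm_ge0 andbT.
apply/ler_addgt0Pr => e e0; rewrite add0r.
have [d d0 Hd] := Om_small e0.
have [p0|p0] := eqVneq (enorm p) 0; first by rewrite p0 ltW.
have pp : 0 < enorm p by rewrite lt0r p0 enorm_ge0.
have := Hp ((d / enorm p) *: p).
move=> /le_trans; move: (Hd ((d / enorm p) *: p)).
rewrite enormZ ger0_norm ?divr_ge0 ?(ltW d0) ?enorm_ge0 // divfK // lexx.
move=> /(_ isT) h /(_ _ h); rewrite dotvZr -sqr_enorm expr2 mulrA divfK // mulrC.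
by rewrite ler_pM2r.
Qed.

(** The first-order error lies between 0 and [Om h], which is o(|h|); uniqueness of the differential
    then identifies the gradient. *)
Lemma subgradient_differentiable x p :
  (forall h, F x + dotv p h <= F (x + h)) ->
  differentiable F x /\ grad F x = p.
Proof.
move=> Hp.
have cont : continuous (dotv p : 'rV[R]_n -> R^o).
  apply: continuous_eps_delta => y e e0.
  have c0 : 0 < (enorm p + 1) * n.+1%:R by rewrite mulr_gt0 ?ltr_wpDl ?enorm_ge0.
  exists (e / ((enorm p + 1) * n.+1%:R)) => [|z]; first exact: divr_gt0.
  rewrite ler_pdivlMr // mulrC => yz.
  have -> : dotv p y - dotv p z = dotv p (y - z) by rewrite dotvDr dotvNr.
  apply: (@le_trans _ _ (enorm p * enorm (y - z))).
    rewrite ler_norml dotv_le_enorm andbT lerNl -dotvNr -(enormN (y - z)).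
    exact: dotv_le_enorm.
  apply: le_trans yz; rewrite -mulrA.
  by rewrite ler_pM ?enorm_ge0 ?enorm_le_norm // lerDl.
have bound e : 0 < e ->
    exists2 d, 0 < d & forall h, `|h| <= d -> `|F (x + h) - (F x + dotv p h)| <= e * `|h|.
  (* Little-o refers to the sup norm, so [e] and [d] are both divided by the comparison factor
     [n.+1]. *)
  move=> e0; have e1 : 0 < e / n.+1%:R by rewrite divr_gt0.
  have [d d0 Hd] := Om_small e1.
  exists (d / n.+1%:R); first by rewrite divr_gt0.
  move=> h; rewrite ler_pdivlMr // mulrC => hd.
  rewrite ger0_norm; last by rewrite subr_ge0.
  have := Hd h (le_trans (enorm_le_norm h) hd).
  have := ler_wpM2l (ltW e1) (enorm_le_norm h).
  have := subgradient_upper Hp h.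
  by rewrite mulrA divfK // => h1 h2 /le_trans/(_ h2); lra.
(* The expansion centred at 0 serves uniqueness of the differential, the one centred at [x] its
   existence. *)
have expansion : F \o shift x = cst (F x) + dotv p +o_ (0 : 'rV[R]_n) id.
  apply/eqaddoP => e /bound[d d0 Hd].
  apply: filterS (near_norm_le 0 d0) => h /=; rewrite sub0r normrN => hd.
  by rewrite !fctE /= (addrC h); apply: Hd.
have expansionx : F = (fun y => F x + dotv p (y - x)) +o_ x (fun y => y - x).
  apply/eqaddoP => e /bound[d d0 Hd].
  apply: filterS (near_norm_le x d0) => y /=; rewrite distrC => yd.
  by rewrite !fctE /= -{1}(subrK x y) (addrC _ x); apply: Hd.
have diff : differentiable F x.
  (* The differential is a chosen linear map with the expansion property, so the witness [dotv p] is
     enough. *)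
  apply/diffP => /=.
  apply: (@getPex _ (fun (df : {linear 'rV[R]_n -> R^o}) => continuous df /\
    forall y, F y = F (lim (nbhs x)) + df (y - lim (nbhs x))
                  +o_(y \near x) (y - lim (nbhs x)))).
  exists (dotv p : {linear _ -> R^o}); split => //; apply: eqaddoEx => z.
  by rewrite {1}expansionx lim_id.
split => //; apply/rowP => i; rewrite mxE deriveE // (diff_unique cont expansion).
rewrite -[LHS]/(dotv p _) /dotv (bigD1 i) //= !mxE !eqxx mulr1 big1 ?addr0 // => j ji.
by rewrite mxE (negbTE ji) andbF mulr0.
Qed.

Lemma smooth_convex_C1 : C1 F /\ (forall x, enorm (grad F x) <= L) /\
  (forall x p, (forall h, F x + dotv p h <= F (x + h)) -> grad F x = p).
Proof.
have sub x : forall h, F x + dotv (grad F x) h <= F (x + h).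
  have [p Hp] := ex_subgradient x.
  by have [_ ->] := subgradient_differentiable Hp.
split; last first.
  split; last by move=> x p /subgradient_differentiable[].
  move=> x; have [->//|g0] := eqVneq (enorm (grad F x)) 0.
  have gp : 0 < enorm (grad F x) by rewrite lt0r g0 enorm_ge0.
  rewrite -(ler_pM2r gp) -expr2 sqr_enorm.
  by have := sub x (grad F x); have := F_lip x (grad F x); lra.
split; first by move=> x; have [] := subgradient_differentiable (sub x).
apply: continuous_eps_delta => x e e0.
have e2 : 0 < e / 2 by rewrite divr_gt0.
have [d d0 Hd] := Om_small e2.
have c0 : 0 < (2 * L + 1) * n.+1%:R by rewrite mulr_gt0 ?ltr_wpDl ?mulr_ge0.
(* Chosen so that 2L|x - y| <= d e / 2 in the Euclidean norm. *)
exists (d * (e / 2) / ((2 * L + 1) * n.+1%:R)) => [|y].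
  by rewrite divr_gt0 // mulr_gt0.
rewrite distrC ler_pdivlMr // mulrC => xy.
apply: (le_trans (norm_le_enorm _)).
set v := _ - _.
have [->|v0] := eqVneq (enorm v) 0; first exact: ltW.
have vp : 0 < enorm v by rewrite lt0r v0 enorm_ge0.
(* Testing the gradient difference [v] along itself at length [d] gives d|v| = <v, h> <= 2L|x - y| +
   Om(h), which is at most d e. *)
set h := (d / enorm v) *: v.
have eh : enorm h = d by rewrite enormZ gtr0_norm ?divr_gt0 // divfK.
have dh : dotv v h = d * enorm v.
  by rewrite dotvZr -sqr_enorm expr2 mulrA divfK.
have := sub x h; have := subgradient_upper (sub y) h.
have := Hd h; rewrite eh lexx => /(_ isT).
have := F_lip x (y - x); have := F_lip (y + h) (x - y).
have -> : y + h + (x - y) = x + h by rewrite addrC addrA subrK.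
have -> : x + (y - x) = y by rewrite addrC subrK.
rewrite -(enormN (x - y)) opprB.
have yx : 2 * L * enorm (y - x) <= d * (e / 2).
  apply: le_trans xy; rewrite -[leRHS]mulrA.
  by apply: ler_pM; rewrite ?mulr_ge0 ?enorm_ge0 ?enorm_le_norm ?lerDl.
move=> h1 h2 h3 h4 h5.
rewrite -(ler_pM2l d0).
by move: dh; rewrite {1}/v dotvDl dotvNl; lra.
Qed.

End ConvexRegularity.

(** * The largest convex minorant inherits regularity from [g] *)

Section ConvexEnvelope.
Context {R : realType} {n : nat}.
Implicit Types (x y h : 'rV[R]_n) (c : 'rV[R]_n -> R).
Variables (g l : 'rV[R]_n -> R).
Hypotheses (l_cvx : cvx l) (l_le : forall x, l x <= g x).

(** The minorant [l] makes the set nonempty and [g x] bounds it, so the real supremum is a true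
    one. *)
Definition envelope x : R :=
  sup [set c x | c in [set c | cvx c /\ forall y, c y <= g y]].

Lemma le_envelope c x : cvx c -> (forall y, c y <= g y) -> c x <= envelope x.
Proof.
move=> c_cvx cg; apply: ub_le_sup; last by exists c.
by exists (g x) => _ [d [_ dg] <-].
Qed.

Lemma envelope_le_ub x a :
  (forall c, cvx c -> (forall y, c y <= g y) -> c x <= a) -> envelope x <= a.
Proof.
move=> ca; apply: ge_sup; first by exists (l x), l.
by move=> _ [c [c_cvx cg] <-]; exact: ca.
Qed.

Lemma envelope_le x : envelope x <= g x.
Proof. exact: envelope_le_ub. Qed.

Lemma envelope_cvx : cvx envelope.
Proof.
move=> x y t t0 t1; apply: envelope_le_ub => c c_cvx cg.
by rewrite (le_trans (c_cvx _ _ _ t0 t1)) // lerD // ler_wpM2l ?subr_ge0 ?le_envelope.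
Qed.

(** The translate by [h] of the envelope, lowered by [a], is itself a convex minorant of [g]. *)
Lemma envelope_translate h a : (forall x, g (x + h) <= g x + a) ->
  forall x, envelope (x + h) <= envelope x + a.
Proof.
move=> gh x; rewrite -lerBlDr.
apply: (@le_envelope (fun x => envelope (x + h) - a)) => [y z t t0 t1|y].
  have -> : t *: y + (1 - t) *: z + h = t *: (y + h) + (1 - t) *: (z + h).
    by apply/rowP => i; rewrite !mxE; ring.
  by have := envelope_cvx (y + h) (z + h) t0 t1; lra.
by rewrite lerBlDr (le_trans (envelope_le _)).
Qed.

Lemma envelope_second_difference h a :
  (forall x, g (x + h) + g (x - h) <= 2 * g x + a) ->
  forall x, envelope (x + h) + envelope (x - h) <= 2 * envelope x + a.
Proof.
move=> gh x.
suff : (envelope (x + h) + envelope (x - h) - a) / 2 <= envelope x by lra.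
apply: (@le_envelope (fun x => (envelope (x + h) + envelope (x - h) - a) / 2)).
  move=> y z t t0 t1.
  have tr k : t *: y + (1 - t) *: z + k = t *: (y + k) + (1 - t) *: (z + k).
    by apply/rowP => i; rewrite !mxE; ring.
  rewrite !tr.
  have := envelope_cvx (y + h) (z + h) t0 t1.
  by have := envelope_cvx (y - h) (z - h) t0 t1; lra.
move=> y; have := gh y; have := envelope_le (y + h).
by have := envelope_le (y - h); lra.
Qed.

End ConvexEnvelope.

(** * The jet on a compact set: uniform positivity of the gap and dominating pairs *)

Lemma within_continuous_near (R : realType) (V W : normedModType R) (A : set V)
    (f : V -> W) (x : V) (e : R) : {within A, continuous f} -> A x -> 0 < e ->
  \forall y \near x, A y -> `|f x - f y| <= e.
Proof.
move=> /subspace_continuousP fA /fA/cvgrPdist_le/(_ _) fx e0.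
by have := fx _ e0; rewrite near_withinE.
Qed.

Section Jet.
Context {R : realType} {n : nat}.
Variables (C : set 'rV[R]_n) (f : 'rV[R]_n -> R) (G : 'rV[R]_n -> 'rV[R]_n).
Variable (M : R).
Implicit Types (x y z h : 'rV[R]_n).
Hypothesis C_neq0 : C !=set0.
Hypothesis C_compact : compact C.
Hypothesis G_cont : {within C, continuous G}.
Hypothesis jet_cvx : forall x y, C x -> C y -> f x - f y >= dotv (G y) (x - y).
Hypothesis jet_unique : forall x y, C x -> C y ->
  f x - f y = dotv (G y) (x - y) -> G x = G y.
Hypothesis G_le : forall y, C y -> enorm (G y) <= M.

Definition gap y z : R := f y - f z - dotv (G z) (y - z).

Lemma gap_ge0 y z : C y -> C z -> 0 <= gap y z.
Proof. by move=> Cy Cz; rewrite subr_ge0 jet_cvx. Qed.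

Lemma M_ge0 : 0 <= M.
Proof. by have [y Cy] := C_neq0; exact: le_trans (enorm_ge0 _) (G_le Cy). Qed.

Lemma G_near y e : C y -> 0 < e ->
  \forall z \near y, C z -> enorm (G z - G y) <= e.
Proof.
move=> Cy e0; have e1 : 0 < e / n.+1%:R by rewrite divr_gt0.
apply: filterS (within_continuous_near G_cont Cy e1) => z /= + Cz => /(_ Cz).
rewrite distrC ler_pdivlMr // mulrC.
exact: le_trans (enorm_le_norm _).
Qed.

Lemma enorm_near y e : 0 < e -> \forall z \near y, enorm (z - y) <= e.
Proof.
move=> e0; have e1 : 0 < e / n.+1%:R by rewrite divr_gt0.
apply: filterS (near_norm_le y e1) => z /=.
rewrite distrC ler_pdivlMr // mulrC.
exact: le_trans (enorm_le_norm _).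
Qed.

(** Lower semicontinuity of the gap: [f y] is bounded below by the tangent at [y0], and [f z] above
    through the tangent at [z] evaluated at [z0]. *)
Lemma gap_lower y0 z0 y z : C y0 -> C z0 -> C y -> C z ->
  gap y0 z0 - 2 * M * enorm (y - y0)
    - enorm (G z - G z0) * (enorm (y - y0) + enorm (y0 - z0)) <= gap y z.
Proof.
move=> Cy0 Cz0 Cy Cz.
have h1 := jet_cvx Cy Cy0; have h2 := jet_cvx Cz0 Cz.
have h3 := dotv_le_enorm (- G y0) (y - y0).
have h4 := dotv_le_enorm (G z0) (y - y0).
have h5 := dotv_le_enorm (G z - G z0) (y - z0).
have h6 : enorm (y - z0) <= enorm (y - y0) + enorm (y0 - z0).
  by rewrite -(subrKA y0 y) enormD.
have h7 := ler_wpM2l (enorm_ge0 (G z - G z0)) h6.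
have h8 := ler_wpM2r (enorm_ge0 (y - y0)) (G_le Cy0).
have h9 := ler_wpM2r (enorm_ge0 (y - y0)) (G_le Cz0).
move: h1 h2 h3 h4 h5 h7 h8 h9; rewrite /gap enormN !dotvE; lra.
Qed.

(** If the gap vanishes at the base pair, (b) gives [G y0 = G z0], and nearby the premise on [G]
    fails, so any [d] will do. Otherwise the gap keeps half its value nearby. *)
Lemma gap_local y0 z0 e : C y0 -> C z0 -> 0 < e -> exists2 d, 0 < d &
  \forall y \near y0 & z \near z0, C y -> C z -> e <= enorm (G z - G y) -> d <= gap y z.
Proof.
move=> Cy0 Cz0 e0; have := gap_ge0 Cy0 Cz0; rewrite le_eqVlt => /predU1P[D0|D0].
  exists 1 => //.
  have Gyz : G y0 = G z0.
    by apply: jet_unique => //; apply/eqP; rewrite -subr_eq0 -/(gap y0 z0) -D0.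
  have e3 : 0 < e / 3 by rewrite divr_gt0.
  exists ([set y | C y -> enorm (G y - G y0) <= e / 3],
          [set z | C z -> enorm (G z - G z0) <= e / 3]).
    by split; exact: G_near.
  move=> [y z] /= [yP zP] Cy Cz.
  have := enormD (G z - G z0) (G y0 - G y); rewrite {1}Gyz subrKA.
  rewrite -(enormN (G y0 - G y)) opprB.
  by have := yP Cy; have := zP Cz; lra.
(* For r <= 1, the total loss in [gap_lower] is at most r K. *)
set K := 2 * M + 1 + enorm (y0 - z0).
have K0 : 0 < K by have := M_ge0; have := enorm_ge0 (y0 - z0); rewrite /K; lra.
set r := Num.min 1 (gap y0 z0 / 2 / K).
have r0 : 0 < r by rewrite lt_min ltr01 !divr_gt0.
have r1 : r <= 1 by rewrite ge_min lexx.
have rK : r * K <= gap y0 z0 / 2 by rewrite -ler_pdivlMr // ge_min lexx orbT.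
exists (gap y0 z0 / 2); first exact: divr_gt0.
exists ([set y | enorm (y - y0) <= r], [set z | C z -> enorm (G z - G z0) <= r]).
  by split; [exact: enorm_near | exact: G_near].
move=> [y z] /= [yP zP] Cy Cz _; apply: le_trans (gap_lower Cy0 Cz0 Cy Cz).
have h1 : 2 * M * enorm (y - y0) <= 2 * M * r by rewrite ler_wpM2l ?mulr_ge0 ?M_ge0.
have h2 : enorm (G z - G z0) * (enorm (y - y0) + enorm (y0 - z0)) <=
    r * (1 + enorm (y0 - z0)).
  by rewrite ler_pM ?addr_ge0 ?enorm_ge0 ?zP // lerD2r (le_trans yP).
by move: rK h1 h2; rewrite /K; clear; clearbody r; lra.
Qed.

(** Compactness of [C] x [C] in near-covering form, with [d] tending to 0 from the right: a local
    bound remains valid for every smaller [d]. *)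
Lemma gap_uniform e : 0 < e -> exists2 d, 0 < d &
  forall y z, C y -> C z -> e <= enorm (G z - G y) -> d <= gap y z.
Proof.
move=> e0.
have := compact_setX C_compact C_compact => /compact_near_coveringP.
move=> /(_ R 0^'+ (fun d p => C p.1 -> C p.2 ->
    e <= enorm (G p.2 - G p.1) -> d <= gap p.1 p.2) _) covering.
have : \forall d \near (0 : R)^'+, C `*` C `<=` [set p | C p.1 -> C p.2 ->
    e <= enorm (G p.2 - G p.1) -> d <= gap p.1 p.2].
  apply: covering => -[y0 z0] /= [Cy0 Cz0].
  have [d d0 Hd] := gap_local Cy0 Cz0 e0.
  exists ([set p | C p.1 -> C p.2 -> e <= enorm (G p.2 - G p.1) -> d <= gap p.1 p.2],
          [set d' | d' <= d]).
    split => //=; exact: nbhs_right_le.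
  move=> [[y z] d'] /= [yzP d'd] Cy Cz Hyz; apply: le_trans d'd _; exact: yzP.
move=> near_d.
have [d [d0 Hd]] : exists d : R, 0 < d /\ C `*` C `<=` [set p | C p.1 -> C p.2 ->
    e <= enorm (G p.2 - G p.1) -> d <= gap p.1 p.2].
  near (0 : R)^'+ => d; exists d; split; first by [].
  by near: d.
by exists d => // y z Cy Cz; exact: (Hd (y, z)).
Unshelve. all: by end_near. Qed.

(* Membership of [(e, A)] means that [|h| * (e + A * |h|)], added to the tangent at
   any [y] in [C], gives a function above all the other tangents. *)
Definition dominating : set (R * R) := [set p | [/\ 0 <= p.1, 0 <= p.2 &
  forall y z h, C y -> C z ->
    dotv (G z - G y) h - gap y z <= enorm h * (p.1 + p.2 * enorm h)]].

Lemma dominating_ge0 p : dominating p -> 0 <= p.1 /\ 0 <= p.2.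
Proof. by case. Qed.

Lemma enormB_le y z : C y -> C z -> enorm (G z - G y) <= 2 * M.
Proof.
move=> Cy Cz; rewrite (le_trans (enormD _ _)) // enormN.
by have := G_le Cy; have := G_le Cz; lra.
Qed.

(** This constant modulus gives eta <= 2M. *)
Lemma dominating_lipschitz : dominating (2 * M, 0).
Proof.
split => //=; first by rewrite mulr_ge0 ?M_ge0.
move=> y z h Cy Cz; rewrite mul0r addr0.
have := dotv_le_enorm (G z - G y) h; have := gap_ge0 Cy Cz.
by have := ler_wpM2r (enorm_ge0 h) (enormB_le Cy Cz); lra.
Qed.

(** Where [G] varies by less than [e], the linear term is enough; elsewhere the gap is at least [d],
    and with the quadratic term it absorbs 2M|h|. *)
Lemma dominating_small e : 0 < e -> exists A, dominating (e, A).
Proof.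
move=> e0; have [d d0 Hd] := gap_uniform e0.
exists (M ^+ 2 / d); have A0 : 0 <= M ^+ 2 / d by rewrite divr_ge0 ?sqr_ge0 ?ltW.
split => //=; first exact: ltW.
move=> y z h Cy Cz; have h0 := enorm_ge0 h.
have cs := dotv_le_enorm (G z - G y) h.
have Ah : 0 <= M ^+ 2 / d * enorm h ^+ 2 by rewrite mulr_ge0 ?sqr_ge0.
have [Ge|eG] := ltP (enorm (G z - G y)) e.
  have := ler_wpM2r h0 (ltW Ge); have := gap_ge0 Cy Cz.
  by move: cs Ah; lra.
have := ler_wpM2r h0 (enormB_le Cy Cz); have gd := Hd _ _ Cy Cz eG.
(* AM-GM: [2 M |h| <= d + M^2 |h|^2 / d] *)
have : 0 <= (d - M * enorm h) ^+ 2 / d by rewrite divr_ge0 ?sqr_ge0 ?ltW.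
have -> : (d - M * enorm h) ^+ 2 / d =
    d - 2 * M * enorm h + M ^+ 2 / d * enorm h ^+ 2 by field; rewrite gt_eqF.
have := mulr_ge0 (ltW e0) h0.
by move: cs gd; lra.
Qed.

(** * The upper function and the extension of the jet *)

Let phi (h : 'rV[R]_n) : R := radial dominating h.

Lemma phi0 : phi 0 = 0.
Proof. by rewrite /phi /radial enorm0 mul0r. Qed.

(** At h = x - y, the left side of the dominating inequality is exactly the tangent at [z] minus the
    tangent at [y]. *)
Lemma tangent_le y z x : C y -> C z ->
  f z + dotv (G z) (x - z) <= f y + dotv (G y) (x - y) + phi (x - y).
Proof.
move=> Cy Cz.
have : dotv (G z - G y) (x - y) - gap y z <= phi (x - y).
  rewrite /phi /radial; apply: (le_modulus dominating_lipschitz (enorm_ge0 _)).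
  by move=> p [_ _]; exact.
by rewrite /gap !dotvE; lra.
Qed.

Definition upper_jet x : R :=
  inf [set f y + dotv (G y) (x - y) + phi (x - y) | y in C].

Lemma upper_jet_le x y : C y ->
  upper_jet x <= f y + dotv (G y) (x - y) + phi (x - y).
Proof.
move=> Cy; apply: ge_inf; last by exists y.
by exists (f y + dotv (G y) (x - y)) => _ [z Cz <-]; exact: tangent_le.
Qed.

Lemma le_upper_jet x a :
  (forall y, C y -> a <= f y + dotv (G y) (x - y) + phi (x - y)) -> a <= upper_jet x.
Proof.
move=> ay; apply: lb_le_inf; last by move=> _ [y Cy <-]; exact: ay.
by have [y Cy] := C_neq0; exists (f y + dotv (G y) (x - y) + phi (x - y)), y.
Qed.

(** The constant is M from the tangent plus 2 (2M) from [radial_lipschitz]. *)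
Lemma upper_jet_lipschitz x h : upper_jet (x + h) <= upper_jet x + 5 * M * enorm h.
Proof.
rewrite -lerBlDr; apply: le_upper_jet => y Cy.
have := upper_jet_le (x + h) Cy; rewrite (addrAC x h) (dotvDr _ (x - y)).
have := radial_lipschitz dominating_ge0 dominating_lipschitz (x - y) h.
have := dotv_le_enorm (G y) h; have := ler_wpM2r (enorm_ge0 h) (G_le Cy).
by rewrite -!/(phi _); lra.
Qed.

(** One [y] serves both x + h and x - h, so the linear parts in [h] cancel and only the radial
    second difference remains. *)
Lemma upper_jet_second_difference x h :
  upper_jet (x + h) + upper_jet (x - h) <= 2 * upper_jet x + 8 * phi h.
Proof.
suff : (upper_jet (x + h) + upper_jet (x - h) - 8 * phi h) / 2 <= upper_jet x by lra.
apply: le_upper_jet => y Cy.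
have := upper_jet_le (x + h) Cy; have := upper_jet_le (x - h) Cy.
rewrite (addrAC x h) (addrAC x (- h)) !(dotvDr _ (x - y)) dotvNr.
have := radial_second_difference dominating_ge0 dominating_lipschitz (x - y) h.
by rewrite -!/(phi _); lra.
Qed.

Lemma tangent_cvx y : cvx (fun x => f y + dotv (G y) (x - y)).
Proof.
move=> u v t _ _; rewrite le_eqVlt; apply/orP; left; apply/eqP.
by rewrite !dotvE; ring.
Qed.

Lemma convex_C1_extension : exists F : 'rV[R]_n -> R,
  [/\ cvx F, C1 F, forall x, C x -> F x = f x, forall x, C x -> grad F x = G x
    & forall x, enorm (grad F x) <= 5 * M].
Proof.
have [y0 Cy0] := C_neq0.
have tangent_jet y : C y -> forall x, f y + dotv (G y) (x - y) <= upper_jet x.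
  by move=> Cy x; apply: le_upper_jet => z Cz; exact: tangent_le.
pose F := envelope upper_jet.
have F_ge y x : C y -> f y + dotv (G y) (x - y) <= F x.
  move=> Cy.
  exact: (@le_envelope _ _ _ _ x (tangent_cvx y) (tangent_jet y Cy)).
have F_cvx := envelope_cvx (tangent_cvx y0) (tangent_jet y0 Cy0).
(* At [y] both the tangent at [y] and its term in the infimum equal [f y]. *)
have FC y : C y -> F y = f y.
  move=> Cy; apply/eqP; rewrite eq_le; apply/andP; split; last first.
    by have := F_ge y y Cy; rewrite subrr dotvC dotv0 addr0.
  have := envelope_le (tangent_cvx y0) (tangent_jet y0 Cy0) y.
  move=> /le_trans; apply.
  by have := upper_jet_le y Cy; rewrite subrr dotvC dotv0 phi0 !addr0.
have Om_small e : 0 < e ->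
    exists2 d, 0 < d & forall h, enorm h <= d -> 8 * phi h <= e * enorm h.
  move=> e0; have e8 : 0 < e / 8 by rewrite divr_gt0.
  have [d d0 Hd] := modulus_small dominating_ge0 dominating_small e8.
  exists d => // h hd.
  have := ler_wpM2l (enorm_ge0 h) (Hd _ (enorm_ge0 h) hd).
  by rewrite /phi /radial; lra.
have L0 : 0 <= 5 * M by rewrite mulr_ge0 ?M_ge0.
have [F_C1 [F_grad F_sub]] := @smooth_convex_C1 R n F (fun h => 8 * phi h) (5 * M)
  F_cvx L0
  (fun x h => envelope_translate (tangent_cvx y0) (tangent_jet y0 Cy0)
     (fun x => upper_jet_lipschitz x h) x)
  (fun x h => envelope_second_difference (tangent_cvx y0) (tangent_jet y0 Cy0)
     (fun x => upper_jet_second_difference x h) x)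
  Om_small.
(* Since [F y = f y], the tangent at [y] exhibits [G y] as a subgradient of [F]. *)
exists F; split => // y Cy; apply: F_sub => h.
by have := F_ge y (y + h) Cy; rewrite (FC y Cy) addrAC subrr add0r.
Qed.

End Jet.

(** * Passage to library convexity and to extended real suprema *)

Lemma cvx_convex_function (R : realType) (n : nat) (F : 'rV[R]_n -> R) :
  cvx F -> convex_function [set: convex_lmodType 'rV[R]_n] F.
Proof. by move=> F_cvx t x y _ _; exact: F_cvx. Qed.

(** The continuous image of a compact set is bounded, and nonemptiness excludes the value minus
    infinity. *)
Lemma sup_enorm_EFin (R : realType) (n : nat) (C : set 'rV[R]_n)
    (G : 'rV[R]_n -> 'rV[R]_n) : C !=set0 -> compact C -> {within C, continuous G} ->
  exists M : R, sup_enorm C G = M%:E.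
Proof.
move=> [y0 Cy0] C_compact G_cont.
have [N [_ HN]] := compact_bounded (continuous_compact G_cont C_compact).
have G_le y : C y -> enorm (G y) <= n.+1%:R * (N + 1).
  move=> Cy; rewrite (le_trans (enorm_le_norm _)) // ler_wpM2l //.
  by apply: (HN (N + 1)); [rewrite ltrDl | exists y].
exists (fine (sup_enorm C G)); rewrite fineK // ge0_fin_numE.
  apply: (@le_lt_trans _ _ (n.+1%:R * (N + 1))%:E); last exact: ltry.
  by apply: ge_ereal_sup => _ [y Cy <-]; rewrite lee_fin G_le.
apply: (@le_trans _ _ (enorm (G y0))%:E); first by rewrite lee_fin enorm_ge0.
by apply: ereal_sup_ubound; exists y0.
Qed.

Theorem mainTheorem8 (R : realType) (n : nat) :
  exists k : R, 1 <= k /\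
    forall (C : set 'rV[R]_n) (f : 'rV[R]_n -> R) (G : 'rV[R]_n -> 'rV[R]_n),
      C !=set0 -> compact C ->
      {within C, continuous G} ->
      (forall x y, C x -> C y -> f x - f y >= dotv (G y) (x - y)) ->
      (forall x y, C x -> C y ->
         f x - f y = dotv (G y) (x - y) -> G x = G y) ->
      exists F : 'rV[R]_n -> R,
        [/\ convex_function [set: convex_lmodType 'rV[R]_n] F,
            C1 F,
            (forall x, C x -> F x = f x) /\ (forall x, C x -> grad F x = G x),
            (sup_enorm setT (grad F) <= k%:E * sup_enorm C G)%E
          & C 0 ->
            (C1norm F <= k%:E *
               ereal_inf [set C1norm phi | phi in
                 [set phi : 'rV[R]_n -> R |
                   [/\ C1 phi,
                       (forall x, C x -> phi x = f x)
                     & (forall x, C x -> grad phi x = G x)]]])%E].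
Proof.
exists 5; split; first by rewrite ler1n.
move=> C f G C0 C_compact G_cont jet_cvx jet_unique.
have [M supM] := sup_enorm_EFin C0 C_compact G_cont.
have G_le y : C y -> enorm (G y) <= M.
  by move=> Cy; rewrite -lee_fin -supM; apply: ereal_sup_ubound; exists y.
have [F [F_cvx F_C1 FC gradFC F_grad]] :=
  convex_C1_extension C0 C_compact G_cont jet_cvx jet_unique G_le.
have supF : (sup_enorm setT (grad F) <= 5%:E * M%:E)%E.
  by apply: ge_ereal_sup => _ [x _ <-]; rewrite -EFinM lee_fin.
exists F; split => //; first exact: cvx_convex_function.
  by rewrite supM.
(* As 5 >= 1, |f(0)| + 5M <= 5 (|f(0)| + M). *)
move=> C_0; apply: (@le_trans _ _ (5%:E * (`|f 0|%:E + M%:E))%E).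
  rewrite /C1norm FC // muleDr //; apply: leeD => //.
  by rewrite -EFinM lee_fin ler_peMl // ler1n.
apply: lee_wpmul2l; first by rewrite lee_fin.
(* A competitor has value [f 0] at 0 and gradient [G] on [C], so its gradient supremum over the
   whole space is at least the one of [G] over [C]. *)
apply: le_ereal_inf_tmp => _ [phi [_ phi_f phi_G] <-].
rewrite /C1norm phi_f // leeD2l // -supM.
apply: ge_ereal_sup => _ [y Cy <-]; rewrite -phi_G //.
by apply: ereal_sup_ubound; exists y.
Qed.
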